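(* Consider the equation $$r-\beta+\frac{1}{2\gamma}\eta^2(\nu)+\beta(\ln\beta-\ln h)+\left[m_1(\nu)+\frac{\eta(\nu)}{\gamma}\rho m_2(\nu)(1-\gamma)\right]\frac{h_\nu}{h}+\frac12m_2^2(\nu)\left[\frac{\rho^2(1-\gamma)^2}{\gamma}-\gamma\right]\frac{h_\nu^2}{h^2}+\frac12m_2^2(\nu)\frac{h_{\nu\nu}}{h}=0$$ and assume that $h$ is conjectured in the form $h(\nu)=\exp\left\{A_0+\sum_{k=1}^n\frac1kA_k\nu^k\right\}$ with constants $A_0,\dots,A_n$, i.e. $\omega(x,\nu)=\frac{x^{1-\gamma}}{1-\gamma}\exp\left\{(1-\gamma)\left(A_0+\sum_{k=1}^n\frac1kA_k\nu^k\right)\right\}$. (i) If $\eta(\nu)$ is a constant, then the equation has an analytical solution (of this form) when $n=0$. (ii) If $\eta^2(\nu)$, $m_1(\nu)$, $\eta(\nu)m_2(\nu)$ and $m_2^2(\nu)$ are linear in $\nu$, then the equation has an analytical solution (of this form) when $n=1$. (iii) If $\eta^2(\nu)$ is quadratic in $\nu$, $m_1(\nu)$ and $\eta(\nu)m_2(\nu)$ are linear in $\nu$, and $m_2^2(\nu)$ is a constant, then the equation has an analytical solution (of this form) when $n=2$.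
   Context: Parameters: $r>0$, $\beta>0$, $\gamma>0$ with $\gamma\neq1$, $\rho\in[-1,1]$; $\eta,m_1,m_2$ are real functions of the state variable $\nu$, where $d\nu_t=m_1(\nu_t)dt+m_2(\nu_t)dW^\nu_t$ and $\eta(\nu_t)$ is the market price of risk. ''Linear in $\nu$'' means a first-order polynomial $a+b\nu$. The displayed equation is to hold identically in $\nu$ on the state space. It arises from the infinite-horizon consumption–investment problem with recursive utility and unit elasticity of intertemporal substitution through the ansatz $\omega(x,\nu)=\frac{x^{1-\gamma}}{1-\gamma}h(\nu)^{1-\gamma}$ for the HJB equation. For $n=0$ the sum is empty. An ''analytical solution'' means a function $h$ of the stated exponential-polynomial form satisfying the equation.
   Formalization: In (ii) and (iii) m_2 is assumed not identically zero on the state space; the constants A_k are complex in general, and real if γ>1, or if γ<1 and the quadratic for A_n has nonnegative discriminant; with real constants and no such conditions the claims fail. *)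

(* Defs.v *)
From Stdlib Require Import Reals.
From Coquelicot Require Import Coquelicot.
Open Scope R_scope.

Definition state_space (D : R -> Prop) : Prop :=
  (forall a b x, D a -> D b -> a <= x <= b -> D x) /\
  (exists a b, a < b /\ D a /\ D b).

(* The leading coefficients may vanish: a constant counts as linear, and a
   linear function as quadratic. *)
Definition constant_on (D : R -> Prop) (f : R -> R) (a : R) : Prop :=
  forall nu, D nu -> f nu = a.
Definition linear_on (D : R -> Prop) (f : R -> R) (a b : R) : Prop :=
  forall nu, D nu -> f nu = a + b * nu.
Definition quadratic_on (D : R -> Prop) (f : R -> R) (a b c : R) : Prop :=
  forall nu, D nu -> f nu = a + b * nu + c * nu ^ 2.

(** Real constants. *)

Definition exp_poly (n : nat) (A : nat -> R) (nu : R) : R :=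
  exp (A 0%nat + sum_n_m (fun k => / INR k * A k * nu ^ k) 1 n).

Definition hjb_lhs (r beta gamma rho : R) (eta m1 m2 h : R -> R) (nu : R) : R :=
  r - beta + 1 / (2 * gamma) * eta nu ^ 2 + beta * (ln beta - ln (h nu))
  + (m1 nu + eta nu / gamma * rho * m2 nu * (1 - gamma))
      * (Derive h nu / h nu)
  + 1 / 2 * m2 nu ^ 2 * (rho ^ 2 * (1 - gamma) ^ 2 / gamma - gamma)
      * (Derive h nu ^ 2 / h nu ^ 2)
  + 1 / 2 * m2 nu ^ 2 * (Derive_n h 2 nu / h nu).

Definition solves (D : R -> Prop) (r beta gamma rho : R)
    (eta m1 m2 h : R -> R) : Prop :=
  forall nu, D nu -> hjb_lhs r beta gamma rho eta m1 m2 h nu = 0.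

(** Complex constants; the state variable, the parameters and [eta], [m1],
    [m2] remain real. *)

Definition Cexp (z : C) : C := (exp (Re z) * cos (Im z), exp (Re z) * sin (Im z)).

Definition DeriveC (f : R -> C) (x : R) : C :=
  (Derive (fun t => Re (f t)) x, Derive (fun t => Im (f t)) x).

Definition Cexp_poly (n : nat) (A : nat -> C) (nu : R) : C :=
  Cexp (A 0%nat
        + sum_n_m (fun k => RtoC (/ INR k) * A k * RtoC (nu ^ k)) 1 n)%C.

(* [lnh] stands for the function "ln h", see [solvesC]. *)
Definition hjb_lhsC (r beta gamma rho : R) (eta m1 m2 : R -> R)
    (h lnh : R -> C) (nu : R) : C :=
  (RtoC (r - beta + 1 / (2 * gamma) * eta nu ^ 2)
   + RtoC beta * (RtoC (ln beta) - lnh nu)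
   + RtoC (m1 nu + eta nu / gamma * rho * m2 nu * (1 - gamma))
       * (DeriveC h nu / h nu)
   + RtoC (1 / 2 * m2 nu ^ 2 * (rho ^ 2 * (1 - gamma) ^ 2 / gamma - gamma))
       * (Cpow (DeriveC h nu) 2 / Cpow (h nu) 2)
   + RtoC (1 / 2 * m2 nu ^ 2) * (DeriveC (DeriveC h) nu / h nu))%C.

(* For complex-valued [h], "ln h" is a continuous branch of the logarithm of
   [h] along the state space. *)
Definition solvesC (D : R -> Prop) (r beta gamma rho : R)
    (eta m1 m2 : R -> R) (h : R -> C) : Prop :=
  exists lnh : R -> C, forall nu, D nu ->
    continuous lnh nu /\ Cexp (lnh nu) = h nu /\
    hjb_lhsC r beta gamma rho eta m1 m2 h lnh nu = RtoC 0.

(* Matching the coefficients of [nu ^ n] (n = 1, 2) gives a quadratic equation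
   for [A n]:
     K/2 * s * (A n)^2 + (b + rho*(1-gamma)/gamma * q - beta/n) * A n
       + e / (2*gamma) = 0,    K = rho^2*(1-gamma)^2/gamma - gamma + 1,
   where b and q are the slopes of [m1] and [eta * m2], and e, s are the
   coefficients of [nu ^ n] in [eta ^ 2] and of [nu ^ (2 - n)] in [m2 ^ 2].
   Since (eta * m2)^2 = eta^2 * m2^2 forces e * s = q^2, its discriminant is
   the expression below.  K has the sign of 1 - gamma, so the discriminant is
   nonnegative for gamma > 1, but it can be negative for gamma < 1, and then
   there is no solution with real constants when s <> 0. *)
Definition discriminant (beta gamma rho : R) (n : nat) (b q : R) : R :=
  (b + rho * (1 - gamma) / gamma * q - beta / INR n) ^ 2
  - (rho ^ 2 * (1 - gamma) ^ 2 / gamma - gamma + 1) / gamma * q ^ 2.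

(* Some nondegeneracy of [m2] is needed as well: if m2 = 0 on the state space
   and b = beta / n, the quadratic above reduces to e / (2*gamma) = 0. *)

(* Main.v *)
Require Import Defs.
From Stdlib Require Import Reals Lra Lia FunctionalExtensionality.
From Coquelicot Require Import Coquelicot.
Open Scope R_scope.

(** Write [h = exp P] with [P = a0 + a1 nu + a2 nu^2 / 2].  Then [h' / h = P'] and
    [h'' / h = P'^2 + P''], so the equation becomes
    [r - beta + beta ln beta + eta^2 / (2 gamma) - beta P
     + (m1 + kappa eta m2) P' + K/2 m2^2 P'^2 + m2^2 / 2 P'' = 0]
    with [kappa = rho (1 - gamma) / gamma] and
    [K = rho^2 (1 - gamma)^2 / gamma - gamma + 1].  Under the assumptions on
    [eta^2], [m1], [eta m2], [m2^2] the left side is a polynomial of degree at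
    most 2 in [nu], and it suffices to make its coefficients vanish, from the
    highest degree down ([matching_coefficients]).  The constant coefficient
    is solved by [a0], since [beta <> 0]; for constant [eta] and constant [h] it
    is the whole equation.

    The top coefficient is a quadratic equation in the top unknown with
    leading coefficient a multiple of [K].  The point of the proof is that it
    does have a solution, real when the discriminant is nonnegative:

    - [K <> 0], because [K] is [1 - gamma] times a positive quantity
      ([riccati_factor_neq_0]); hence the equation is truly quadratic unless
      [m2^2] has no slope (degree one case).
    - [(eta m2)^2 = eta^2 m2^2] relates the coefficients of the data
      ([product_identity]).  It puts the discriminant in the form
      [discriminant], nonnegative for [gamma > 1] as [K < 0] there.  In the
      degree one case with [m2^2] a nonzero constant, it forces [eta^2] to be
      constant too, and then [a1 = 0] is a root.
    - In the degree two case the middle coefficient is affine in [a1], with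
      slope [L] equal to the derivative of the quadratic at [a2] minus
      [beta / 2].  The root with minus sign in front of the square root makes
      that derivative have nonpositive real part ([quadratic_root]), so
      [Re L < 0] and [a1] exists.

    Everything is computed over the complex numbers.  When [a1] and [a2] are
    real so is [a0], and a real exponent turns the complex equation into the
    real one ([hjb_lhsC_RtoC]). *)

(** * Complex-valued functions of a real variable *)

Lemma C_eq (z w : C) : Re z = Re w -> Im z = Im w -> z = w.
Proof. destruct z, w; unfold Re, Im; simpl; intros; subst; reflexivity. Qed.

Lemma Cexp_neq_0 (z : C) : Cexp z <> RtoC 0.
Proof.
  intros H. injection H as H1 H2.
  pose proof (exp_pos (Re z)) as He. pose proof (sin2_cos2 (Im z)) as Hsc.
  unfold Rsqr in Hsc.
  assert (Hc : cos (Im z) = 0) by nra.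
  assert (Hs : sin (Im z) = 0) by nra.
  rewrite Hc, Hs in Hsc. lra.
Qed.

Lemma Cexp_RtoC (x : R) : Cexp (RtoC x) = RtoC (exp x).
Proof.
  unfold Cexp. simpl. rewrite cos_0, sin_0.
  apply C_eq; simpl; ring.
Qed.

Definition is_deriveC (f : R -> C) (x : R) (l : C) : Prop :=
  is_derive (fun t => Re (f t)) x (Re l) /\ is_derive (fun t => Im (f t)) x (Im l).

Lemma is_deriveC_unique (f : R -> C) (x : R) (l : C) :
  is_deriveC f x l -> DeriveC f x = l.
Proof.
  intros [H1 H2]. unfold DeriveC.
  apply C_eq; simpl; apply is_derive_unique; assumption.
Qed.

Lemma is_deriveC_mult (f g : R -> C) (x : R) (df dg : C) :
  is_deriveC f x df -> is_deriveC g x dg ->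
  is_deriveC (fun t => (f t * g t)%C) x (df * g x + f x * dg)%C.
Proof.
  intros [Hf1 Hf2] [Hg1 Hg2]; split.
  - apply (is_derive_ext (fun t => Re (f t) * Re (g t) - Im (f t) * Im (g t))).
    { intros t. symmetry. apply re_mult. }
    evar_last.
    apply (is_derive_minus (fun t => Re (f t) * Re (g t))
             (fun t => Im (f t) * Im (g t)));
      apply (is_derive_mult (K := R_AbsRing)); try eassumption; apply Rmult_comm.
    rewrite re_plus, !re_mult. unfold minus, plus, opp, mult; simpl. ring.
  - apply (is_derive_ext (fun t => Re (f t) * Im (g t) + Im (f t) * Re (g t))).
    { intros t. symmetry. apply im_mult. }
    evar_last.
    apply (is_derive_plus (fun t => Re (f t) * Im (g t))
             (fun t => Im (f t) * Re (g t)));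
      apply (is_derive_mult (K := R_AbsRing)); try eassumption; apply Rmult_comm.
    rewrite im_plus, !im_mult. unfold plus, mult; simpl. ring.
Qed.

Lemma is_deriveC_exp (f : R -> C) (x : R) (df : C) :
  is_deriveC f x df ->
  is_deriveC (fun t => Cexp (f t)) x (df * Cexp (f x))%C.
Proof.
  intros [H1 H2].
  split; unfold Cexp; simpl.
  - evar_last.
    apply (is_derive_mult (K := R_AbsRing) (fun t => exp (Re (f t)))
             (fun t => cos (Im (f t)))).
    + apply (is_derive_comp exp (fun t => Re (f t))); [apply is_derive_exp | exact H1].
    + apply (is_derive_comp cos (fun t => Im (f t))); [apply is_derive_cos | exact H2].
    + apply Rmult_comm.
    + unfold plus, mult, scal; simpl. unfold mult; simpl. unfold Re, Im. ring.
  - evar_last.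
    apply (is_derive_mult (K := R_AbsRing) (fun t => exp (Re (f t)))
             (fun t => sin (Im (f t)))).
    + apply (is_derive_comp exp (fun t => Re (f t))); [apply is_derive_exp | exact H1].
    + apply (is_derive_comp sin (fun t => Im (f t))); [apply is_derive_sin | exact H2].
    + apply Rmult_comm.
    + unfold plus, mult, scal; simpl. unfold mult; simpl. unfold Re, Im. ring.
Qed.

(** * The equation for an exponential of a quadratic *)

(** The factor 1/2 is the one in the ansatz [sum A_k nu^k / k]; it makes the
    derivative [a1 + a2 nu]. *)
Definition quad_exponent (a0 a1 a2 : C) (nu : R) : C :=
  (a0 + a1 * RtoC nu + RtoC (/ 2) * a2 * RtoC (nu ^ 2))%C.

Lemma is_deriveC_affine (a1 a2 : C) (x : R) :
  is_deriveC (fun t => (a1 + a2 * RtoC t)%C) x a2.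
Proof.
  split; simpl.
  - auto_derive; [exact I | unfold Re; ring].
  - auto_derive; [exact I | unfold Im; ring].
Qed.

Lemma is_deriveC_quad_exponent (a0 a1 a2 : C) (x : R) :
  is_deriveC (quad_exponent a0 a1 a2) x (a1 + a2 * RtoC x)%C.
Proof.
  split; simpl.
  - auto_derive; [exact I | unfold Re; simpl; field].
  - auto_derive; [exact I | unfold Im; simpl; field].
Qed.

Lemma is_deriveC_continuous (f : R -> C) (x : R) (l : C) :
  is_deriveC f x l -> continuous f x.
Proof.
  intros [H1 H2].
  assert (C1 : continuous (fun t => Re (f t)) x)
    by (apply (ex_derive_continuous (V := R_NormedModule)); eexists; exact H1).
  assert (C2 : continuous (fun t => Im (f t)) x)
    by (apply (ex_derive_continuous (V := R_NormedModule)); eexists; exact H2).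
  apply filterlim_locally. intros eps.
  pose proof (proj1 (filterlim_locally _ _) C1 eps) as B1.
  pose proof (proj1 (filterlim_locally _ _) C2 eps) as B2.
  generalize (filter_and _ _ B1 B2). apply filter_imp.
  intros t [b1 b2]. split; assumption.
Qed.

(** The coefficient of [m2^2 P'^2 / 2]: the sum of the factors of [(h'/h)^2] and
    of [h''/h], since the latter contributes [P'^2 + P'']. *)
Definition riccati_factor (gamma rho : R) : R :=
  rho ^ 2 * (1 - gamma) ^ 2 / gamma - gamma + 1.

(** The exponential cancels from all quotients, which leaves a Riccati
    expression in the exponent. *)
Lemma hjb_lhsC_exp (r beta gamma rho : R) (eta m1 m2 : R -> R)
    (a0 a1 a2 : C) (nu : R) :
  hjb_lhsC r beta gamma rho eta m1 m2
    (fun t => Cexp (quad_exponent a0 a1 a2 t)) (quad_exponent a0 a1 a2) nu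
  = (RtoC (r - beta + beta * ln beta + / (2 * gamma) * eta nu ^ 2)
     - RtoC beta * quad_exponent a0 a1 a2 nu
     + RtoC (m1 nu + rho * (1 - gamma) / gamma * (eta nu * m2 nu))
         * (a1 + a2 * RtoC nu)
     + RtoC (riccati_factor gamma rho / 2 * m2 nu ^ 2)
         * ((a1 + a2 * RtoC nu) * (a1 + a2 * RtoC nu))
     + RtoC (m2 nu ^ 2 / 2) * a2)%C.
Proof.
  pose proof (Cexp_neq_0 (quad_exponent a0 a1 a2 nu)) as Hne.
  assert (D1 : forall t, DeriveC (fun t => Cexp (quad_exponent a0 a1 a2 t)) t
             = ((a1 + a2 * RtoC t) * Cexp (quad_exponent a0 a1 a2 t))%C).
  { intros t. apply is_deriveC_unique, is_deriveC_exp, is_deriveC_quad_exponent. }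
  assert (D2 : DeriveC (DeriveC (fun t => Cexp (quad_exponent a0 a1 a2 t))) nu
     = (a2 * Cexp (quad_exponent a0 a1 a2 nu)
        + (a1 + a2 * RtoC nu) * ((a1 + a2 * RtoC nu)
            * Cexp (quad_exponent a0 a1 a2 nu)))%C).
  { rewrite (functional_extensionality _ _ D1).
    apply is_deriveC_unique.
    apply (is_deriveC_mult (fun t => (a1 + a2 * RtoC t)%C)).
    - apply is_deriveC_affine.
    - apply is_deriveC_exp, is_deriveC_quad_exponent. }
  unfold hjb_lhsC. rewrite D2, D1.
  set (E := Cexp (quad_exponent a0 a1 a2 nu)) in *.
  set (Q := quad_exponent a0 a1 a2 nu).
  (* Both sides are brought to common real constants, seen as atoms by [field]. *)
  replace (RtoC (riccati_factor gamma rho / 2 * m2 nu ^ 2))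
    with (RtoC (1 / 2 * m2 nu ^ 2 *
           (rho ^ 2 * (1 - gamma) ^ 2 / gamma - gamma)) + RtoC (1 / 2 * m2 nu ^ 2))%C
    by (rewrite <- RtoC_plus; f_equal; unfold riccati_factor, Rdiv; lra).
  replace (RtoC (m2 nu ^ 2 / 2)) with (RtoC (1 / 2 * m2 nu ^ 2))
    by (f_equal; field).
  replace (RtoC (r - beta + beta * ln beta + / (2 * gamma) * eta nu ^ 2))
    with (RtoC (r - beta + 1 / (2 * gamma) * eta nu ^ 2)
          + RtoC beta * RtoC (ln beta))%C
    by (rewrite <- RtoC_mult, <- RtoC_plus; f_equal; unfold Rdiv; ring).
  replace (m1 nu + rho * (1 - gamma) / gamma * (eta nu * m2 nu))
    with (m1 nu + eta nu / gamma * rho * m2 nu * (1 - gamma))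
    by (unfold Rdiv; ring).
  field. exact Hne.
Qed.

Lemma DeriveC_RtoC (f : R -> R) (x : R) :
  DeriveC (fun t => RtoC (f t)) x = RtoC (Derive f x).
Proof.
  unfold DeriveC, RtoC. simpl. rewrite Derive_const. reflexivity.
Qed.

(** The complex equation contains the real one as the case of real [h] and
    [ln h], so that the real claims follow from the complex
    computation. *)
Lemma hjb_lhsC_RtoC (r beta gamma rho : R) (eta m1 m2 : R -> R)
    (h : R -> R) (nu : R) :
  h nu <> 0 ->
  hjb_lhsC r beta gamma rho eta m1 m2
    (fun t => RtoC (h t)) (fun t => RtoC (ln (h t))) nu
  = RtoC (hjb_lhs r beta gamma rho eta m1 m2 h nu).
Proof.
  intros Hh. unfold hjb_lhsC, hjb_lhs.
  rewrite (functional_extensionality _ _ (DeriveC_RtoC h)).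
  rewrite DeriveC_RtoC.
  change (Derive_n h 2 nu) with (Derive (Derive h) nu).
  rewrite <- !RtoC_pow, <- !RtoC_div, <- !RtoC_mult, <- RtoC_minus,
    <- RtoC_mult, <- !RtoC_plus by (try apply pow_nonzero; exact Hh).
  reflexivity.
Qed.

(** * Quadratic equations and the discriminant *)

(** The root is [(-b - w) / (2k)] with [w] a square root of the discriminant
    and [Re w >= 0], so that [2kX + b = -w].  The sign condition is what makes
    the remaining linear equation of the degree two case solvable.  For a
    negative discriminant [w] is purely imaginary, and [2kX + b] has real
    part 0. *)
Lemma quadratic_root (k b c : R) :
  k <> 0 ->
  exists X : C,
    (RtoC k * (X * X) + RtoC b * X + RtoC c = RtoC 0)%C /\
    2 * k * Re X + b <= 0 /\
    (0 <= b ^ 2 - 4 * k * c -> Im X = 0).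
Proof.
  intros Hk. set (d := b ^ 2 - 4 * k * c).
  assert (Hc : c = (b ^ 2 - d) / (4 * k)) by (unfold d; field; exact Hk).
  destruct (Rle_dec 0 d) as [Hd|Hd].
  - exists (RtoC ((- b - sqrt d) / (2 * k))). split; [|split].
    + rewrite <- !RtoC_mult, <- !RtoC_plus. f_equal.
      rewrite Hc.
      replace (b ^ 2 - d) with (b ^ 2 - sqrt d * sqrt d)
        by (rewrite sqrt_sqrt by exact Hd; reflexivity).
      field. exact Hk.
    + simpl. replace (_ + b) with (- sqrt d) by (field; exact Hk).
      pose proof (sqrt_pos d). lra.
    + intros _. reflexivity.
  - assert (Hd' : 0 <= - d) by lra.
    exists (- b / (2 * k), sqrt (- d) / (2 * k)). split; [|split].
    + apply C_eq; simpl.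
      * rewrite Hc.
        replace (b ^ 2 - d) with (b ^ 2 + sqrt (- d) * sqrt (- d))
          by (rewrite sqrt_sqrt by exact Hd'; ring).
        field. exact Hk.
      * field. exact Hk.
    + simpl. replace (_ + b) with 0 by (field; exact Hk). lra.
    + intros H. contradiction.
Qed.

(** A nondegenerate interval contains two points and their midpoint, enough to
    determine a quadratic. *)
Lemma quadratic_zero_on (D : R -> Prop) (c0 c1 c2 : R) :
  state_space D ->
  (forall nu, D nu -> c0 + c1 * nu + c2 * nu ^ 2 = 0) ->
  c0 = 0 /\ c1 = 0 /\ c2 = 0.
Proof.
  intros [Hconv (a & b & Hab & Ha & Hb)] H.
  assert (Hm : D ((a + b) / 2)) by (apply (Hconv a b); [assumption..|lra]).
  pose proof (H _ Ha) as E1. pose proof (H _ Hb) as E2. pose proof (H _ Hm) as E3.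
  assert (H2 : c2 = 0).
  { apply (Rmult_eq_reg_r ((b - a) ^ 2)); [nra | apply pow_nonzero; lra]. }
  subst c2.
  assert (H1 : c1 = 0).
  { apply (Rmult_eq_reg_r (b - a)); [nra | lra]. }
  subst c1. repeat split; lra.
Qed.

(** [K = (1 - gamma) (rho^2 (1 - gamma) + gamma) / gamma], and the middle factor
    is positive: it lies between [gamma] and [1], as [0 <= rho^2 <= 1]. *)
Lemma riccati_factor_neq_0 (gamma rho : R) :
  0 < gamma -> gamma <> 1 -> -1 <= rho <= 1 -> riccati_factor gamma rho <> 0.
Proof.
  intros Hg Hg1 Hr.
  replace (riccati_factor gamma rho)
    with ((1 - gamma) * (rho ^ 2 * (1 - gamma) + gamma) / gamma)
    by (unfold riccati_factor; field; lra).
  assert (0 <= rho ^ 2 <= 1) by nra.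
  assert (0 < rho ^ 2 * (1 - gamma) + gamma).
  { destruct (Rlt_dec gamma 1); nra. }
  unfold Rdiv. repeat apply Rmult_integral_contrapositive_currified;
    try lra. apply Rinv_neq_0_compat; lra.
Qed.

Lemma riccati_factor_neg (gamma rho : R) :
  1 < gamma -> -1 <= rho <= 1 -> riccati_factor gamma rho < 0.
Proof.
  intros Hg Hr.
  replace (riccati_factor gamma rho)
    with (- ((gamma - 1) * (rho ^ 2 * (1 - gamma) + gamma) * / gamma))
    by (unfold riccati_factor; field; lra).
  assert (0 <= rho ^ 2 <= 1) by nra.
  assert (0 < rho ^ 2 * (1 - gamma) + gamma) by nra.
  apply Ropp_lt_gt_0_contravar.
  repeat apply Rmult_lt_0_compat; try lra. apply Rinv_0_lt_compat; lra.
Qed.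

(** For [gamma > 1] the discriminant is a square plus [- K / gamma * q^2], with
    [K < 0]. *)
Lemma discriminant_nonneg (beta gamma rho : R) (n : nat) (b q : R) :
  0 < gamma -> gamma <> 1 -> -1 <= rho <= 1 ->
  (gamma < 1 -> 0 <= discriminant beta gamma rho n b q) ->
  0 <= discriminant beta gamma rho n b q.
Proof.
  intros Hg Hg1 Hr H.
  destruct (Rlt_dec gamma 1) as [Hlt|Hge]; [exact (H Hlt)|].
  pose proof (riccati_factor_neg gamma rho ltac:(lra) Hr) as HK.
  unfold discriminant. fold (riccati_factor gamma rho).
  assert (0 <= - riccati_factor gamma rho / gamma * q ^ 2).
  { apply Rmult_le_pos; [|apply pow2_ge_0].
    apply Rmult_le_pos; [lra | apply Rlt_le, Rinv_0_lt_compat; lra]. }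
  pose proof (pow2_ge_0 (b + rho * (1 - gamma) / gamma * q - beta / INR n)).
  unfold Rdiv in *. nra.
Qed.

(** Compares the coefficients of [nu] and [nu^2] in [eta^2 m2^2 = (eta m2)^2].
    The disjunction kills the cubic term, so that three points suffice. *)
Lemma product_identity (D : R -> Prop) (eta m2 : R -> R)
    (e0 e1 e2 q0 q1 s0 s1 : R) :
  state_space D ->
  e2 = 0 \/ s1 = 0 ->
  quadratic_on D (fun nu => eta nu ^ 2) e0 e1 e2 ->
  linear_on D (fun nu => eta nu * m2 nu) q0 q1 ->
  linear_on D (fun nu => m2 nu ^ 2) s0 s1 ->
  e0 * s1 + e1 * s0 = 2 * q0 * q1 /\ e1 * s1 + e2 * s0 = q1 ^ 2.
Proof.
  intros HD Hz He Hq Hs.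
  destruct (quadratic_zero_on D (e0 * s0 - q0 ^ 2)
              (e0 * s1 + e1 * s0 - 2 * q0 * q1) (e1 * s1 + e2 * s0 - q1 ^ 2))
    as (_ & H1 & H2); [exact HD | | split; lra].
  intros nu Hnu.
  pose proof (He nu Hnu) as He'. pose proof (Hq nu Hnu) as Hq'.
  pose proof (Hs nu Hnu) as Hs'. cbv beta in *.
  assert (P : (e0 + e1 * nu + e2 * nu ^ 2) * (s0 + s1 * nu) = (q0 + q1 * nu) ^ 2).
  { rewrite <- He', <- Hq', <- Hs'. ring. }
  destruct Hz as [-> | ->]; lra.
Qed.

(** * Matching coefficients *)

Definition coefs (a0 a1 a2 : C) (k : nat) : C :=
  match k with 0 => a0 | 1 => a1 | 2 => a2 | _ => RtoC 0 end%nat.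

Lemma Cexp_poly_coefs (n : nat) (a0 a1 a2 : C) :
  (n = 1%nat /\ a2 = RtoC 0) \/ n = 2%nat ->
  Cexp_poly n (coefs a0 a1 a2) = (fun nu => Cexp (quad_exponent a0 a1 a2 nu)).
Proof.
  intros Hn. apply functional_extensionality. intros nu.
  unfold Cexp_poly, quad_exponent. f_equal. destruct Hn as [[-> ->]| ->].
  - rewrite sum_n_n. simpl. rewrite Rmult_1_r, Rinv_1. ring.
  - rewrite sum_Sn_m, sum_n_n by lia. simpl.
    rewrite !Rmult_1_r, Rinv_1. unfold plus. simpl.
    replace (1 + 1) with 2 by ring. ring.
Qed.

Lemma exp_poly_coefs (n : nat) (a0 a1 a2 : R) :
  (n = 1%nat /\ a2 = 0) \/ n = 2%nat ->
  exp_poly n (fun k => Re (coefs (RtoC a0) (RtoC a1) (RtoC a2) k))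
  = (fun nu => exp (a0 + a1 * nu + / 2 * a2 * nu ^ 2)).
Proof.
  intros Hn. apply functional_extensionality. intros nu.
  unfold exp_poly. f_equal. destruct Hn as [[-> ->]| ->].
  - rewrite sum_n_n. simpl. field.
  - rewrite sum_Sn_m, sum_n_n by lia. unfold plus; simpl. field.
Qed.

Lemma quad_exponent_RtoC (a0 a1 a2 : R) (nu : R) :
  quad_exponent (RtoC a0) (RtoC a1) (RtoC a2) nu
  = RtoC (a0 + a1 * nu + / 2 * a2 * nu ^ 2).
Proof. unfold quad_exponent. rewrite !RtoC_plus, !RtoC_mult. reflexivity. Qed.

(** Descent to the reals: over a real exponent the complex left side is the
    image of the real one. *)
Lemma solves_exp_of_real_exponent (D : R -> Prop) (r beta gamma rho : R)
    (eta m1 m2 : R -> R) (a0 a1 a2 : R) :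
  (forall nu, D nu ->
     hjb_lhsC r beta gamma rho eta m1 m2
       (fun t => Cexp (quad_exponent (RtoC a0) (RtoC a1) (RtoC a2) t))
       (quad_exponent (RtoC a0) (RtoC a1) (RtoC a2)) nu = RtoC 0) ->
  solves D r beta gamma rho eta m1 m2
    (fun nu => exp (a0 + a1 * nu + / 2 * a2 * nu ^ 2)).
Proof.
  intros H nu Hnu. apply RtoC_inj. rewrite <- (H nu Hnu).
  rewrite <- hjb_lhsC_RtoC by apply Rgt_not_eq, exp_pos.
  f_equal; apply functional_extensionality; intros t; rewrite quad_exponent_RtoC.
  - symmetry. apply Cexp_RtoC.
  - rewrite ln_exp. reflexivity.
Qed.

(** The two equations are the coefficients of [nu^2] and of [nu]; [a0] solves
    the remaining one.  The degrees one and two are treated together, as in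
    both of them [s1 * a2 = 0]: this removes the cubic term, and what [s1]
    would add to the other coefficients through [a2]. *)
Lemma matching_coefficients (D : R -> Prop) (n : nat) (r beta gamma rho : R)
    (eta m1 m2 : R -> R) (e0 e1 e2 b0 b1 q0 q1 s0 s1 : R) (a1 a2 : C) :
  beta <> 0 ->
  (n = 1%nat /\ a2 = RtoC 0) \/ (n = 2%nat /\ s1 = 0) ->
  quadratic_on D (fun nu => eta nu ^ 2) e0 e1 e2 ->
  linear_on D m1 b0 b1 ->
  linear_on D (fun nu => eta nu * m2 nu) q0 q1 ->
  linear_on D (fun nu => m2 nu ^ 2) s0 s1 ->
  (RtoC (/ (2 * gamma) * e2)
   + RtoC (b1 + rho * (1 - gamma) / gamma * q1 - beta / 2) * a2
   + RtoC (riccati_factor gamma rho / 2 * s0) * (a2 * a2) = RtoC 0)%C ->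
  (RtoC (/ (2 * gamma) * e1)
   + RtoC (b1 + rho * (1 - gamma) / gamma * q1 - beta) * a1
   + RtoC (b0 + rho * (1 - gamma) / gamma * q0) * a2
   + RtoC (riccati_factor gamma rho / 2 * s1) * (a1 * a1)
   + RtoC (riccati_factor gamma rho * s0) * (a1 * a2) = RtoC 0)%C ->
  (exists A : nat -> C,
     solvesC D r beta gamma rho eta m1 m2 (Cexp_poly n A)) /\
  (Im a1 = 0 -> Im a2 = 0 ->
   exists A : nat -> R, solves D r beta gamma rho eta m1 m2 (exp_poly n A)).
Proof.
  intros Hbeta Hn He Hb Hq Hs H2 H1.
  set (kap := rho * (1 - gamma) / gamma) in *.
  set (K := riccati_factor gamma rho) in *.
  set (ig := / (2 * gamma)) in *.
  set (f0 := r - beta + beta * ln beta + ig * e0).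
  set (a0 := (RtoC (/ beta) * (RtoC f0 + RtoC (b0 + kap * q0) * a1
                + RtoC (K / 2 * s0) * (a1 * a1) + RtoC (s0 / 2) * a2))%C).
  assert (Hn' : (n = 1%nat /\ a2 = RtoC 0) \/ n = 2%nat) by tauto.
  assert (Hs12 : (RtoC s1 * a2 = RtoC 0)%C).
  { destruct Hn as [[_ ->]|[_ ->]]; ring. }
  assert (H0 : (RtoC beta * a0 = RtoC f0 + RtoC (b0 + kap * q0) * a1
                + RtoC (K / 2 * s0) * (a1 * a1) + RtoC (s0 / 2) * a2)%C).
  { unfold a0. rewrite Cmult_assoc, <- RtoC_mult, Rinv_r by exact Hbeta. ring. }
  assert (Hsol : forall nu, D nu ->
     hjb_lhsC r beta gamma rho eta m1 m2
       (fun t => Cexp (quad_exponent a0 a1 a2 t)) (quad_exponent a0 a1 a2) nu = RtoC 0).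
  { intros nu Hnu. rewrite hjb_lhsC_exp.
    rewrite (He nu Hnu), (Hb nu Hnu), (Hq nu Hnu), (Hs nu Hnu).
    fold kap K ig. unfold quad_exponent.
    transitivity
      ((RtoC f0 + RtoC (b0 + kap * q0) * a1 + RtoC (K / 2 * s0) * (a1 * a1)
          + RtoC (s0 / 2) * a2 - RtoC beta * a0)
       + RtoC nu *
         (RtoC (ig * e1) + RtoC (b1 + kap * q1 - beta) * a1
          + RtoC (b0 + kap * q0) * a2 + RtoC (K / 2 * s1) * (a1 * a1)
          + RtoC (K * s0) * (a1 * a2))
       + RtoC (nu ^ 2) *
         (RtoC (ig * e2) + RtoC (b1 + kap * q1 - beta / 2) * a2
          + RtoC (K / 2 * s0) * (a2 * a2))
       + (RtoC s1 * a2) * (RtoC (nu / 2) + RtoC (K * nu ^ 2) * a1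
            + RtoC (K / 2 * nu ^ 3) * a2))%C.
    - unfold f0, Rdiv.
      repeat rewrite ?RtoC_plus, ?RtoC_minus, ?RtoC_mult, ?RtoC_pow.
      rewrite (RtoC_inv 2) by lra.
      field.
    - rewrite H0, H1, H2, Hs12. ring. }
  split.
  - exists (coefs a0 a1 a2). rewrite Cexp_poly_coefs by exact Hn'.
    exists (quad_exponent a0 a1 a2). intros nu Hnu. split; [|split].
    + eapply is_deriveC_continuous, is_deriveC_quad_exponent.
    + reflexivity.
    + exact (Hsol nu Hnu).
  - intros R1 R2.
    assert (R0 : Im a0 = 0).
    { unfold a0. rewrite im_scal_l, !im_plus, !im_scal_l, im_RtoC, im_mult, R1, R2.
      ring. }
    assert (E0 : a0 = RtoC (Re a0)) by (apply C_eq; [reflexivity | exact R0]).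
    assert (E1 : a1 = RtoC (Re a1)) by (apply C_eq; [reflexivity | exact R1]).
    assert (E2 : a2 = RtoC (Re a2)) by (apply C_eq; [reflexivity | exact R2]).
    exists (fun k => Re (coefs (RtoC (Re a0)) (RtoC (Re a1)) (RtoC (Re a2)) k)).
    rewrite exp_poly_coefs.
    + apply solves_exp_of_real_exponent. rewrite <- E0, <- E1, <- E2. exact Hsol.
    + destruct Hn' as [[Hn1 Hz]|Hn2]; [left | right; exact Hn2].
      rewrite Hz. split; [exact Hn1 | reflexivity].
Qed.

(** * The exponential-polynomial solutions *)

Theorem theorem4p3 :
  forall (r beta gamma rho : R) (D : R -> Prop) (eta m1 m2 : R -> R),
    0 < r -> 0 < beta -> 0 < gamma -> gamma <> 1 -> -1 <= rho <= 1 ->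
    state_space D ->
    (* (i) *)
    (forall e0 : R,
       constant_on D eta e0 ->
       exists A : nat -> R,
         solves D r beta gamma rho eta m1 m2 (exp_poly 0 A))
    /\
    (* (ii) *)
    (forall e0 e1 b0 b1 q0 q1 s0 s1 : R,
       linear_on D (fun nu => eta nu ^ 2) e0 e1 ->
       linear_on D m1 b0 b1 ->
       linear_on D (fun nu => eta nu * m2 nu) q0 q1 ->
       linear_on D (fun nu => m2 nu ^ 2) s0 s1 ->
       (exists nu, D nu /\ m2 nu <> 0) ->
       (exists A : nat -> C,
          solvesC D r beta gamma rho eta m1 m2 (Cexp_poly 1 A))
       /\
       ((gamma < 1 -> 0 <= discriminant beta gamma rho 1 b1 q1) ->
        exists A : nat -> R,
          solves D r beta gamma rho eta m1 m2 (exp_poly 1 A)))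
    /\
    (* (iii) *)
    (forall e0 e1 e2 b0 b1 q0 q1 s0 : R,
       quadratic_on D (fun nu => eta nu ^ 2) e0 e1 e2 ->
       linear_on D m1 b0 b1 ->
       linear_on D (fun nu => eta nu * m2 nu) q0 q1 ->
       constant_on D (fun nu => m2 nu ^ 2) s0 ->
       (exists nu, D nu /\ m2 nu <> 0) ->
       (exists A : nat -> C,
          solvesC D r beta gamma rho eta m1 m2 (Cexp_poly 2 A))
       /\
       ((gamma < 1 -> 0 <= discriminant beta gamma rho 2 b1 q1) ->
        exists A : nat -> R,
          solves D r beta gamma rho eta m1 m2 (exp_poly 2 A))).
Proof.
  intros r beta gamma rho D eta m1 m2 _ Hbeta Hgamma Hgamma1 Hrho HD.
  pose proof (riccati_factor_neq_0 gamma rho Hgamma Hgamma1 Hrho) as HK.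
  split; [|split].
  - intros e0 He.
    (* For constant [h] only the zeroth-order terms of the equation remain. *)
    set (a0 := / beta * (r - beta + beta * ln beta + / (2 * gamma) * e0 ^ 2)).
    exists (fun _ => a0).
    replace (exp_poly 0 (fun _ => a0))
      with (fun nu => exp (a0 + 0 * nu + / 2 * 0 * nu ^ 2)).
    2:{ apply functional_extensionality. intros nu. unfold exp_poly.
        rewrite sum_n_m_zero by lia. f_equal. unfold zero; simpl. ring. }
    apply solves_exp_of_real_exponent. intros nu Hnu.
    rewrite hjb_lhsC_exp, quad_exponent_RtoC, (He nu Hnu).
    rewrite Cmult_0_l, Cplus_0_l, !Cmult_0_r, !Cplus_0_r.
    rewrite <- RtoC_mult, <- RtoC_minus. f_equal. unfold a0. field. lra.
  - intros e0 e1 b0 b1 q0 q1 s0 s1 He Hb Hq Hs [nu0 [Hnu0 Hm]].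
    assert (He' : quadratic_on D (fun nu => eta nu ^ 2) e0 e1 0).
    { intros nu Hnu. rewrite (He nu Hnu). ring. }
    destruct (product_identity D eta m2 e0 e1 0 q0 q1 s0 s1 HD
                (or_introl eq_refl) He' Hq Hs) as [I1 I2].
    assert (Hs0 : s0 + s1 * nu0 <> 0).
    { rewrite <- (Hs nu0 Hnu0). apply pow_nonzero. exact Hm. }
    assert (HX : exists X : C,
      (RtoC (riccati_factor gamma rho / 2 * s1) * (X * X)
       + RtoC (b1 + rho * (1 - gamma) / gamma * q1 - beta) * X
       + RtoC (/ (2 * gamma) * e1) = RtoC 0)%C /\
      (0 <= discriminant beta gamma rho 1 b1 q1 -> Im X = 0)).
    (* If [s1 = 0] the equation is affine with possibly zero slope; the
       identities give [q1 = 0] and [e1 * s0 = 0], where [s0 <> 0]. *)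
    { destruct (Req_dec s1 0) as [Hs1|Hs1].
      - exists (RtoC 0). split; [|reflexivity].
        assert (e1 = 0) as ->.
        { subst s1. assert (q1 = 0) as -> by nra.
          apply (Rmult_eq_reg_r s0); [lra | intros E; apply Hs0; rewrite E; ring]. }
        rewrite Rmult_0_r. ring.
      - destruct (quadratic_root (riccati_factor gamma rho / 2 * s1)
                    (b1 + rho * (1 - gamma) / gamma * q1 - beta)
                    (/ (2 * gamma) * e1)) as (X & E & _ & HR).
        { apply Rmult_integral_contrapositive_currified; [lra | exact Hs1]. }
        exists X. split; [exact E|]. intros Hd. apply HR.
        unfold discriminant in Hd. fold (riccati_factor gamma rho) in Hd.
        rewrite <- I2 in Hd. eapply Rle_trans; [exact Hd|]. right.
        simpl. field. lra. }
    destruct HX as (X & E & HR).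
    destruct (matching_coefficients D 1 r beta gamma rho eta m1 m2
                e0 e1 0 b0 b1 q0 q1 s0 s1 X (RtoC 0)) as [SC SR];
      try assumption; try lra.
    + left. split; reflexivity.
    + rewrite !Rmult_0_r. ring.
    + etransitivity; [|exact E]. ring.
    + split; [exact SC|]. intros Hd. apply SR; [|reflexivity].
      apply HR. apply discriminant_nonneg; assumption.
  - intros e0 e1 e2 b0 b1 q0 q1 s0 He Hb Hq Hs [nu0 [Hnu0 Hm]].
    assert (Hs' : linear_on D (fun nu => m2 nu ^ 2) s0 0).
    { intros nu Hnu. rewrite (Hs nu Hnu). ring. }
    destruct (product_identity D eta m2 e0 e1 e2 q0 q1 s0 0 HD
                (or_intror eq_refl) He Hq Hs') as [_ I2].
    assert (Hs0 : s0 <> 0).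
    { rewrite <- (Hs nu0 Hnu0). apply pow_nonzero. exact Hm. }
    set (kap := rho * (1 - gamma) / gamma).
    set (K := riccati_factor gamma rho) in *.
    destruct (quadratic_root (K / 2 * s0) (b1 + kap * q1 - beta / 2)
                (/ (2 * gamma) * e2)) as (X & E & HX & HR).
    { apply Rmult_integral_contrapositive_currified; [lra | exact Hs0]. }
    set (L := (RtoC (b1 + kap * q1 - beta) + RtoC (K * s0) * X)%C).
    (* [L] is the derivative of the quadratic at its root [X], minus
       [beta / 2]: its real part is negative by the choice of the root. *)
    assert (HL : L <> RtoC 0).
    { intros EL. apply (f_equal Re) in EL. unfold L in EL.
      rewrite re_plus, re_scal_l, !re_RtoC in EL. lra. }
    set (Y := (- (RtoC (/ (2 * gamma) * e1) + RtoC (b0 + kap * q0) * X) / L)%C).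
    destruct (matching_coefficients D 2 r beta gamma rho eta m1 m2
                e0 e1 e2 b0 b1 q0 q1 s0 0 Y X) as [SC SR];
      try assumption; try lra; fold kap K.
    + right. split; reflexivity.
    + etransitivity; [|exact E]. ring.
    + rewrite Rmult_0_r.
      transitivity (RtoC (/ (2 * gamma) * e1) + RtoC (b0 + kap * q0) * X + L * Y)%C.
      { unfold L. ring. }
      unfold Y. field. exact HL.
    + split; [exact SC|]. intros Hd.
      assert (RX : Im X = 0).
      { apply HR. pose proof (discriminant_nonneg beta gamma rho 2 b1 q1
          Hgamma Hgamma1 Hrho Hd) as Hd'.
        unfold discriminant in Hd'. fold (riccati_factor gamma rho) in Hd'.
        fold kap K in Hd'. rewrite <- I2 in Hd'.
        eapply Rle_trans; [exact Hd'|]. right. simpl. field. lra. }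
      apply SR; [|exact RX].
      assert (EX : X = RtoC (Re X)) by (apply C_eq; [reflexivity | exact RX]).
      assert (EL : L = RtoC (Re L)).
      { apply C_eq; [reflexivity|]. unfold L.
        rewrite im_plus, im_scal_l, !im_RtoC, RX. simpl. ring. }
      assert (Re L <> 0) by (intros E0; apply HL; rewrite EL, E0; reflexivity).
      unfold Y. rewrite EX, EL, <- RtoC_mult, <- RtoC_plus, <- RtoC_opp,
        <- RtoC_div by assumption.
      reflexivity.
Qed.
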